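(* Let $N_1,N_2>1$ be integers and let $K$ be a differential field of characteristic $p$ ($p=0$ or $p$ prime) with derivation $D$. Let $F$ be a differential field extension of $K$. Let $L_1(Y)$ and $L_2(Y)$ be nonzero homogeneous linear differential polynomials, of orders $N_1$ and $N_2$ respectively, with coefficients in $K$. Let $y\in F$ be nonzero, and suppose that one of the following holds: (1) ($p=0$ or $p>N_1+N_2-2$), and $L_1(y)=L_2(1/y)=0$; (2) ($p=0$ or $p>(q+1)(N_1-1)-1$), where $q$ is a positive integer with $N_2\le q$, and $L_1(y)=L_2(y^q)=0$. Then $D^jy/y$ is algebraic over $K$ for all $j\ge 1$. Moreover, for each $j=1,\dots,N_1-1$, the element $D^jy/y$ is a root of a nonzero polynomial with coefficients in $K$ of degree at most $$\frac{(N_2+N_1-2)!}{(N_2-1)!}$$ in case (1), and of degree at most $$\frac{(q(N_1-1)+N_1-2)!}{(q(N_1-1)-1)!}$$ in case (2).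
   Context: A differential field is a field with a single derivation $D$ (an additive map satisfying the Leibniz rule); a differential field extension $F$ of $K$ is a field extension with a derivation on $F$ extending that of $K$, also denoted $D$. A homogeneous linear differential polynomial of order $N$ over $K$ is an expression $L(Y)=c_ND^NY+c_{N-1}D^{N-1}Y+\cdots+c_1DY+c_0Y$ with $c_i\in K$ and $c_N\ne0$; $L(y)$ denotes its value at $Y=y$. *)

(* Defs.v *)
From mathcomp Require Import all_boot all_order all_algebra.

Set Implicit Arguments.
Unset Strict Implicit.
Unset Printing Implicit Defensive.

Import GRing.Theory.
Local Open Scope ring_scope.

(* [pchar R] is the set of primes vanishing in R, so it is empty in
   characteristic 0. *)
Definition has_char (R : nzRingType) (p : nat) : Prop :=
  (p = 0%N /\ [pchar R] =i pred0) \/ p \in [pchar R].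

Definition leibniz (R : nzRingType) (D : R -> R) : Prop :=
  forall x y : R, D (x * y) = D x * y + x * D y.

Record diffField := DiffField {
  diff_sort :> fieldType;
  diff_der : {additive diff_sort -> diff_sort};
  diff_derM : leibniz diff_der }.

Notation "''D' x" := (@diff_der _ x) (at level 10, x at level 8) : ring_scope.
Notation "''D^' j x" := (iter j (@diff_der _) x)
  (at level 10, j at level 8, x at level 8, format "''D^' j  x") : ring_scope.

(* A field extension is given by its embedding, which is necessarily
   injective. *)
Record diffExt (K : diffField) := DiffExt {
  ext_sort :> diffField;
  ext_emb : {rmorphism K -> ext_sort};
  ext_embD : forall a : K, 'D (ext_emb a) = ext_emb ('D a) }.

(* L(Y) = c_N D^N Y + ... + c_1 D Y + c_0 Y with c_N != 0. *)
Record linDiffPoly (K : diffField) (N : nat) := LinDiffPoly {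
  ldp_coef : 'I_N.+1 -> K;
  ldp_lead : ldp_coef ord_max != 0 }.

Definition ldp_eval (K : diffField) (F : diffExt K) (N : nat)
    (L : linDiffPoly K N) (y : F) : F :=
  \sum_(i < N.+1) ext_emb F (ldp_coef L i) * 'D^i y.

Definition algebraic (K : diffField) (F : diffExt K) (x : F) : Prop :=
  algebraicOver (ext_emb F) x.

Definition root_of_degree_le (K : diffField) (F : diffExt K) (x : F)
    (d : nat) : Prop :=
  exists P : {poly K},
    [/\ P != 0, (size P <= d.+1)%N & root (map_poly (ext_emb F) P) x].

(* Main.v *)
Require Import Defs.
From mathcomp Require Import all_boot all_order all_algebra.
From mathcomp Require Import zify ring.

(** Put [n = N1 - 1] and [a_j = D^j y / (j! y)], so that [a_0 = 1]. The first
    equation makes every [D^j y / y] a [K]-linear combination of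
    [a_0, ..., a_n]. The second one gives polynomial relations between
    [a_1, ..., a_n]: the coefficients of [T^m] in [A(T)^q] (when [y ^+ q] is a
    solution) or in [1 / A(T)] (when [1 / y] is), where [A(T) = \sum_j a_j T^j],
    are for every large [m] combinations of the coefficients of small order.
    When [a_j] is given degree [j], the leading forms of these relations vanish
    together only at the origin, so the relations have finitely many common
    solutions, and Bezout's theorem bounds their number.

    Bezout's theorem is replaced by a rewriting argument ([root_of_fil]): if
    generators [v_i] of weights [w_i] satisfy [v_i ^ c_i = ] a [K]-combination of
    monomials of weight less than [w_i c_i], then all monomials are combinations
    of the [\prod_i c_i] ones with exponents less than [c_i], and any element of
    [K[v]] is a root of a polynomial of at most that degree, by linear
    dependence of its powers.

    For [y ^+ q] the generators are the [a_i] themselves and [c_i = q]: the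
    coefficient of order [q i] contains [a_i ^ q], and every other product of
    [q] factors [a_j] of total index [q i] has smaller weight for a strictly
    concave weight function ([weight_le_tangent]). The degree [q ^ n] obtained
    is smaller than the stated one.

    For [1 / y] the generators are the inverse roots [x_k] of the truncation
    [\prod_k (1 - x_k T)] of [A], in a ring extension of [F]
    ([splitting_ring]). Up to lower degree the coefficients of [1 / A] are the
    complete symmetric functions of the [x_k]. The second equation thus makes
    those of order at least [N2] equal to elements of lower degree, and the same
    holds for those of order at least [N2 + k] in the variables left when
    [x_0, ..., x_(k-1)] are dropped ([fl_hsym_drop]). As the one of order
    [N2 + k] has leading term [x_k ^ (N2 + k)] in a graded lexicographic order,
    the degree is at most the product of the [N2 + k] for [k < n], which is the
    stated bound. The factorials to be inverted are those of numbers at most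
    [N2 + n - 1], respectively [q n], and the assumption on the characteristic
    makes them nonzero. *)

Set Implicit Arguments.
Unset Strict Implicit.
Unset Printing Implicit Defensive.

Import GRing.Theory.
Local Open Scope ring_scope.

(** * Linear spans over the base field *)

Section Span.

Variables (K : fieldType) (E : comNzRingType) (iota : {rmorphism K -> E}).
Implicit Types (S T U : E -> Prop) (x y m : E).

(** [E] is only a ring receiving a morphism from [K]: the span is generated
    inductively because neither [E] nor its [K]-span is assumed to be
    finite-dimensional. *)
Inductive kspan S : E -> Prop :=
| kspan0 : kspan S 0
| kspanS a m x : S m -> kspan S x -> kspan S (iota a * m + x).

Lemma kspanD S x y : kspan S x -> kspan S y -> kspan S (x + y).
Proof.
move=> Sx Sy; elim: Sx => [|a m {}x Sm _ IH]; rewrite ?add0r //.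
by rewrite -addrA; apply: kspanS.
Qed.

Lemma kspanZ S a x : kspan S x -> kspan S (iota a * x).
Proof.
elim=> [|b m {}x Sm _ IH]; first by rewrite mulr0; apply: kspan0.
by rewrite mulrDr mulrA -rmorphM; apply: kspanS.
Qed.

Lemma kspan_mem S m : S m -> kspan S m.
Proof.
move=> Sm; rewrite -[m]addr0 -[m]mul1r -(rmorph1 iota).
by apply: kspanS => //; apply: kspan0.
Qed.

Lemma kspanN S x : kspan S x -> kspan S (- x).
Proof. by move=> Sx; rewrite -mulN1r -(rmorphN1 iota); apply: kspanZ. Qed.

Lemma kspanB S x y : kspan S x -> kspan S y -> kspan S (x - y).
Proof. by move=> Sx Sy; apply/kspanD/kspanN. Qed.

Lemma kspan_sum S (I : Type) (r : seq I) (P : pred I) (G : I -> E) :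
  (forall i, P i -> kspan S (G i)) -> kspan S (\sum_(i <- r | P i) G i).
Proof. by move=> SG; apply: big_ind => //; [apply: kspan0 | apply: kspanD]. Qed.

Lemma kspan_trans S T x :
  (forall m, S m -> kspan T m) -> kspan S x -> kspan T x.
Proof.
move=> ST; elim=> [|a m {}x Sm _ IH]; first exact: kspan0.
by apply: kspanD => //; apply/kspanZ/ST.
Qed.

Lemma kspanM S T U x y :
    (forall m m', S m -> T m' -> kspan U (m * m')) ->
  kspan S x -> kspan T y -> kspan U (x * y).
Proof.
move=> STU Sx Ty; elim: Sx => [|a m {}x Sm _].
  by rewrite mul0r; apply: kspan0.
rewrite mulrDl => IH; apply: kspanD => //; rewrite -mulrA; apply: kspanZ.
elim: Ty {IH} => [|b m' {}y Tm' _ IH']; first by rewrite mulr0; apply: kspan0.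
by rewrite mulrDr mulrCA; apply: kspanD => //; apply/kspanZ/STU.
Qed.

Lemma kspan_coord (I : finType) (b : I -> E) x :
    kspan (fun m => exists i, m = b i) x ->
  exists c : I -> K, x = \sum_i iota (c i) * b i.
Proof.
elim=> [|a _ {}x [i ->] _ [c ->]].
  by exists (fun=> 0); rewrite big1 // => i _; rewrite rmorph0 mul0r.
exists (fun j => c j + (if j == i then a else 0)).
under [RHS]eq_bigr do rewrite rmorphD mulrDl.
rewrite big_split /= addrC; congr (_ + _).
rewrite (bigD1 i) //= eqxx big1 ?addr0 // => j /negPf ->.
by rewrite rmorph0 mul0r.
Qed.

(** The powers of [x] of exponent at most [#|I|] are [#|I| + 1] elements of a
    space spanned by [#|I|] elements; the coefficients of a linear relation between them are
    those of the polynomial. *)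
Lemma root_of_powers_span (I : finType) (b : I -> E) x :
    (forall k, kspan (fun m => exists i, m = b i) (x ^+ k)) ->
  exists P : {poly K},
    [/\ P != 0, (size P <= #|I|.+1)%N & root (map_poly iota P) x].
Proof.
move=> xb; pose N := #|I|.
have /fin_all_exists [c xc] : forall k : 'I_N.+1, exists c : I -> K,
    x ^+ k = \sum_i iota (c i) * b i by move=> k; apply/kspan_coord/xb.
pose C : 'M[K]_(N.+1, N) := \matrix_(k, i) c k (enum_val i).
(* [C] has more rows than columns. *)
have /rowV0Pn[r /sub_kermxP rC r0] : kermx C != 0.
  rewrite kermx_eq0 /row_free neq_ltn (leq_ltn_trans (rank_leq_col C)) //.
exists (rVpoly r); split; last 2 first.
- exact: size_poly.
- apply/eqP; rewrite (@horner_coef_wide _ N.+1) ?size_map_poly ?size_poly //.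
  under eq_bigr => k _.
    rewrite coef_map /= coef_rVpoly_ord xc mulr_sumr.
    under eq_bigr => i _ do rewrite mulrA -rmorphM.
    over.
  rewrite exchange_big big1 //= => i _.
  rewrite -mulr_suml -rmorph_sum; move/rowP/(_ (enum_rank i)): rC.
  rewrite !mxE; under eq_bigr do rewrite mxE enum_rankK.
  by move=> ->; rewrite rmorph0 mul0r.
- by apply: contraNneq r0 => r0; rewrite -(rVpolyK r) r0 linear0.
Qed.

End Span.

(** * Weighted degree and reduction to a box of monomials *)

Section Filtration.

Variables (K : fieldType) (E : comNzRingType) (iota : {rmorphism K -> E}).
Variables (n : nat) (v : 'I_n -> E) (w : 'I_n -> nat).
Implicit Types (d e : nat) (k : 'I_n -> nat) (x : E).

Definition monom k : E := \prod_i v i ^+ k i.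

Definition fil d : E -> Prop :=
  kspan iota (fun m => exists2 k, m = monom k & (\sum_i w i * k i <= d)%N).

Lemma fil_mon d e x : (d <= e)%N -> fil d x -> fil e x.
Proof.
move=> de; apply: kspan_trans => _ [k -> kd]; apply: kspan_mem.
by exists k => //; apply: leq_trans de.
Qed.

Lemma filM d e x y : fil d x -> fil e y -> fil (d + e) (x * y).
Proof.
apply: kspanM => _ _ [k -> kd] [l -> le].
apply: kspan_mem; exists (fun i => k i + l i)%N.
  by rewrite -big_split; apply: eq_bigr => i _; rewrite exprD.
by under eq_bigr do rewrite mulnDr; rewrite big_split leq_add.
Qed.

Lemma fil1 d : fil d 1.
Proof.
apply: kspan_mem; exists (fun=> 0%N); first by rewrite /monom big1.
by rewrite big1 // => i _; rewrite muln0.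
Qed.

Lemma filX d x j : fil d x -> fil (d * j) (x ^+ j).
Proof.
move=> dx; elim: j => [|j IH]; first exact: fil1.
by rewrite exprS mulnS; apply: filM.
Qed.

Lemma fil_var i : fil (w i) (v i).
Proof.
apply: kspan_mem; exists (fun j => (j == i) : nat).
  by rewrite /monom (bigD1 i) //= eqxx big1 ?mulr1 // => j /negPf ->.
rewrite (bigD1 i) //= eqxx muln1 big1 ?addn0 // => j /negPf ->.
by rewrite muln0.
Qed.

Variable c : 'I_n -> nat.
Hypothesis wpos : forall i, (0 < w i)%N.
Hypothesis vlow : forall i, fil (w i * (c i).+1).-1 (v i ^+ (c i).+1).

Let box_monom (b : {dffun forall i : 'I_n, 'I_(c i).+1}) := monom (fun i => b i).

(** Each [v i ^+ (c i).+1] can be rewritten with strictly smaller weight, so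
    the rewriting terminates, and it stops only at monomials all of whose
    exponents are at most [c i]. This is the part of the theory of Groebner
    bases with pure powers as leading terms that bounds the dimension of the
    quotient from above. *)
Lemma fil_box d x : fil d x -> kspan iota (fun m => exists b, m = box_monom b) x.
Proof.
elim/ltn_ind: d x => d IH x; apply: kspan_trans => _ [k -> kd].
have [/forallP kc | /forallPn[i]] := boolP [forall i, (k i <= c i)%N].
  apply: kspan_mem; exists [ffun i => inord (k i)].
  by apply: eq_bigr => i _; rewrite ffunE inordK ?ltnS.
rewrite -ltnNge => ki.
pose k' j := if j == i then (k i - (c i).+1)%N else k j.
have -> : monom k = v i ^+ (c i).+1 * monom k'.
  rewrite /monom (bigD1 i) //= [in RHS](bigD1 i) //= mulrA -exprD /k' eqxx.
  rewrite subnKC //; by congr (_ * _); apply: eq_bigr => j /negPf ->.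
have wk : (\sum_j w j * k j = w i * (c i).+1 + \sum_j w j * k' j)%N.
  rewrite (bigD1 i) //= [in RHS](bigD1 i) //= addnA -mulnDr /k' eqxx.
  rewrite subnKC //; by congr addn; apply: eq_bigr => j /negPf ->.
have fk' : fil (\sum_j w j * k' j)%N (monom k') by apply: kspan_mem; exists k'.
apply: IH (filM (vlow i) fk').
by move: kd; rewrite wk; have := wpos i; lia.
Qed.

(** The replacement for the Bezout bound: the box has [\prod_i (c i).+1]
    monomials and contains, up to linear combinations, all powers of [x]. *)
Lemma root_of_fil d x : fil d x ->
  exists P : {poly K},
    [/\ P != 0, (size P <= (\prod_i (c i).+1).+1)%N & root (map_poly iota P) x].
Proof.
move=> dx; have := @root_of_powers_span _ _ iota _ box_monom x _.
rewrite card_dep_ffun foldrE big_map /= big_enum /=.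
under eq_bigr do rewrite card_ord.
by apply=> j; apply: fil_box (filX j dx).
Qed.

End Filtration.

(** * Splitting a polynomial with constant coefficient 1 *)

(** The roots wanted are those of the reversed polynomial [P], which is monic,
    so that one of them exists in the nonzero ring [R[X]/P]. A ring extension
    suffices here, since every morphism from a field to a nonzero ring is
    injective. *)
Lemma splitting_ring n (R : comNzRingType) (A : {poly R}) :
    A`_0 = 1 -> (size A <= n.+1)%N ->
  exists (E : comNzRingType) (f : {rmorphism R -> E}) (s : seq E),
    size s = n /\ map_poly f A = \prod_(x <- s) (1 - x *: 'X).
Proof.
elim: n R A => [|n IH] R A A0 sA.
  exists R, idfun, [::]; split=> //.
  by rewrite map_poly_id // big_nil (size1_polyC sA) A0.
pose P := \poly_(i < n.+2) A`_(n.+1 - i).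
have sP : size P = n.+2 by rewrite size_poly_eq // subnn A0 oner_eq0.
have mP : P \is monic by rewrite monicE lead_coefE sP coef_poly ltnSn subnn A0.
pose g : {rmorphism R -> {poly %/ P}} := in_qpoly P \o polyC.
pose x : {poly %/ P} := in_qpoly P 'X.
have xP : \sum_(i < n.+2) x ^+ i * g A`_(n.+1 - i) = 0.
  transitivity (in_qpoly P P); last first.
    apply/val_inj; rewrite /= /mk_monic sP mP /=.
    exact: Pdiv.RingMonic.rmodpp.
  rewrite [X in _ = in_qpoly P X]poly_def rmorph_sum /=.
  by apply: eq_bigr => i _; rewrite -mul_polyC mulrC rmorphM rmorphXn.
(* The quotient of [A] by [1 - x X] as power series; it has degree at most
   [n] because its next coefficient is the value of [P] at [x]. *)
pose A1 := \poly_(j < n.+1) \sum_(i < j.+1) x ^+ (j - i) * g A`_i.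
have [] := IH _ A1.
- by rewrite coef_poly /= big_ord1 A0 rmorph1 mulr1.
- exact: size_poly.
move=> E [f [s [ss fs]]]; exists E, (f \o g), (f x :: s).
split; first by rewrite /= ss.
rewrite big_cons -fs map_poly_comp.
suff -> : map_poly g A = (1 - x *: 'X) * A1.
  by rewrite rmorphM rmorphB rmorph1 /= map_polyZ /= map_polyX.
have step j : (\sum_(i < j.+2) x ^+ (j.+1 - i) * g A`_i =
     x * (\sum_(i < j.+1) x ^+ (j - i) * g A`_i) + g A`_j.+1).
  rewrite big_ord_recr /= subnn expr0 mul1r mulr_sumr; congr (_ + _).
  by apply: eq_bigr => i _; rewrite mulrA -exprS subSn // -ltnS.
apply/polyP=> j; rewrite coef_map mulrBl mul1r coefB -scalerAl coefZ.
rewrite coefXM !coef_poly.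
case: j => [|j] /=; first by rewrite big_ord1 expr0 mul1r mulr0 subr0.
rewrite !ltnS; have [jn | nj | ->] := ltngtP j n.
- by rewrite step addrC addKr.
- by rewrite nth_default ?rmorph0 ?mulr0 ?subr0 // (leq_trans sA).
apply/eqP; rewrite sub0r -addr_eq0 addrC -step.
rewrite (reindex_inj rev_ord_inj) /= -[X in _ == X]xP; apply/eqP.
by apply: eq_bigr => i _; rewrite !subSS subKn // -ltnS.
Qed.

(** * Complete homogeneous symmetric functions *)

Section Complete.

Variable E : comNzRingType.
Implicit Types (x : E) (s : seq E) (m : nat).

Fixpoint hsym s m : E :=
  if s is x :: s' then \sum_(j < m.+1) x ^+ j * hsym s' (m - j) else (m == 0)%:R.

Lemma hsym_cons x s m :
  hsym (x :: s) m = \sum_(j < m.+1) x ^+ j * hsym s (m - j).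
Proof. by []. Qed.

Lemma hsym0 s : hsym s 0 = 1.
Proof. by elim: s => //= x s IH; rewrite big_ord1 mul1r IH. Qed.

Lemma hsymS x s m : hsym (x :: s) m.+1 = hsym s m.+1 + x * hsym (x :: s) m.
Proof.
rewrite !hsym_cons big_ord_recl mul1r mulr_sumr; congr (_ + _).
by apply: eq_bigr => i _; rewrite mulrA -exprS.
Qed.

(** The complete symmetric functions are the coefficients of the power series
    inverse to [\prod_(x <- s) (1 - x X)]. *)
Lemma hsymE s m :
  \sum_(j < m.+1) (\prod_(x <- s) (1 - x *: 'X))`_j * hsym s (m - j) = (m == 0)%:R.
Proof.
elim: s => [|x s IH].
  rewrite big_nil big_ord_recl coef1 mul1r subn0 big1 ?addr0 // => i _.
  by rewrite coef1 mul0r.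
rewrite -IH big_cons; set P := \prod_(_ <- s) _.
move: (hsym (x :: s)) (hsym0 (x :: s)) (hsymS x s) => h h0 hS.
under eq_bigr do rewrite mulrBl mul1r coefB -scalerAl coefZ coefXM mulrBl.
rewrite sumrB [in X in _ - X]big_ord_recl /= mulr0 mul0r add0r.
rewrite big_ord_recr [RHS]big_ord_recr /= subnn h0 hsym0 addrAC; congr (_ + _).
rewrite -sumrB; apply: eq_bigr => i _.
by rewrite /bump add0n add1n -(subnSK (ltn_ord i)) hS; ring.
Qed.

End Complete.

(** * Taylor coefficients in a differential field *)

Section Taylor.

Variable F : diffField.
Implicit Types (x y : F) (m : nat).

Lemma leibniz_iter m x y :
  'D^m (x * y) = \sum_(i < m.+1) ('D^i x * 'D^(m - i) y) *+ 'C(m, i).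
Proof.
elim: m => [|m IH]; first by rewrite big_ord1.
rewrite iterS IH raddf_sum /=.
under eq_bigr do rewrite raddfMn /= diff_derM mulrnDl -iterS -[in X in _ + X]iterS.
rewrite big_split /= big_ord_recr /= [in X in _ + X]big_ord_recl /=.
rewrite [RHS]big_ord_recr [in RHS]big_ord_recl /= !bin0 !binn !subnn !subn0.
set a := _ *+ 1; set b := _ *+ 1; set S1 := \sum_(i < m) _.
set S2 := \sum_(i < m) _; set S3 := \sum_(i < m) _.
suff -> : S3 = S1 + S2 by rewrite -!addrA [a + _]addrC -!addrA [in RHS](addrCA b).
rewrite -big_split; apply: eq_bigr => i _.
by rewrite /bump /= !add1n binS mulrnDr addrC subSS -(subnSK (ltn_ord i)).
Qed.

(** [x |-> \sum_m taylor m x T^m] is multiplicative, in the range of [m] where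
    [m`!] is invertible; this turns iterated derivatives of [1 / y] and
    [y ^+ q] into coefficients of an inverse and of a power. *)
Definition taylor m x := 'D^m x / (m`!)%:R.

Lemma fact_neq0_le m i : (i <= m)%N -> (m`!)%:R != 0 :> F -> (i`!)%:R != 0 :> F.
Proof.
move=> im; apply: contraNneq => i0.
have /dvdnP[c ->] : (i`! %| m`!)%N by rewrite -(bin_fact im) mulnCA dvdn_mulr.
by rewrite natrM i0 mulr0.
Qed.

Lemma taylorM m x y : (m`!)%:R != 0 :> F ->
  taylor m (x * y) = \sum_(i < m.+1) taylor i x * taylor (m - i) y.
Proof.
move=> m0; rewrite /taylor leibniz_iter mulr_suml; apply: eq_bigr => i _.
have im : (i <= m)%N by rewrite -ltnS.
have i0 := fact_neq0_le im m0; have mi0 := fact_neq0_le (leq_subr i m) m0.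
move: (m0); rewrite -(bin_fact im) !natrM => /[!mulf_eq0] /norP[b0 _].
by rewrite -mulr_natr; field; rewrite b0 i0 mi0.
Qed.

Lemma der_taylor m x : (m`!)%:R != 0 :> F -> 'D^m x = (m`!)%:R * taylor m x.
Proof. by move=> m0; rewrite mulrC divfK. Qed.

Lemma taylor1 m : taylor m 1 = (m == 0)%:R.
Proof.
case: m => [|m]; first by rewrite /taylor divr1.
have D1 : 'D (1 : F) = 0.
  by apply: (addrI ('D (1 : F))); rewrite addr0 -{3}[1]mulr1 diff_derM mulr1 mul1r.
by rewrite /taylor iterSr D1 iter_fix ?raddf0 // mul0r.
Qed.

End Taylor.

(** * Derivatives of a solution of a linear differential equation *)

Section LinearODE.

Variables (K : diffField) (F : diffExt K) (N : nat) (L : linDiffPoly K N) (z : F).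
Hypothesis N_gt0 : (0 < N)%N.
Hypothesis Lz : ldp_eval L z = 0.

(** The equation expresses the derivative of order [N] through the lower ones,
    so their [K]-span is stable under the derivation. *)
Lemma der_span m :
  kspan (ext_emb F) (fun x => exists2 i, (i < N)%N & x = 'D^i z) ('D^m z).
Proof.
elim: m => [|m IH].
  by apply: kspan_mem; exists 0%N.
rewrite iterS; elim: IH => [|a _ x [i iN ->] _ IHx].
  by rewrite raddf0; apply: kspan0.
rewrite raddfD diff_derM /= ext_embD; apply: kspanD => //; apply: kspanD.
  by apply/kspanZ/kspan_mem; exists i.
apply: kspanZ; rewrite -iterS; have [iN' | Ni] := ltnP i.+1 N.
  by apply: kspan_mem; exists i.+1.
have {Ni iN} -> : i.+1 = N by apply/eqP; rewrite eqn_leq iN.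
move/eqP: Lz; rewrite /ldp_eval big_ord_recr /= addrC addr_eq0 => /eqP LzN.
have c0 : ext_emb F (ldp_coef L ord_max) != 0 by rewrite fmorph_eq0 ldp_lead.
rewrite -['D^N z](mulKf c0) LzN -fmorphV; apply/kspanZ/kspanN/kspan_sum => j _.
by apply/kspanZ/kspan_mem; exists j.
Qed.

End LinearODE.

Section Transfer.

Variables (K : diffField) (F : diffExt K) (E : comNzRingType).
Variable f : {rmorphism F -> E}.

Lemma taylor_emb m (z : F) : taylor m z = ext_emb F (m`!)%:R^-1 * 'D^m z.
Proof. by rewrite /taylor mulrC fmorphV rmorph_nat. Qed.

(** A polynomial relation over [K] may be found in an extension ring of [F]. *)
Lemma root_descent (x : F) d :
    (exists P : {poly K},
      [/\ P != 0, (size P <= d.+1)%N & root (map_poly (f \o ext_emb F) P) (f x)]) ->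
  root_of_degree_le x d.
Proof.
move=> [P [P0 sP]]; rewrite map_poly_comp /root horner_map fmorph_eq0 => rP.
by exists P.
Qed.

Variables (N : nat) (L : linDiffPoly K N) (z c : F) (S : E -> Prop).
Hypotheses (N_gt0 : (0 < N)%N) (Lz : ldp_eval L z = 0).
Hypothesis factN : ((N.-1)`!)%:R != 0 :> F.
Hypothesis Sz :
  forall i, (i < N)%N -> kspan (f \o ext_emb F) S (f (taylor i z * c)).

(** The form in which a differential equation is used: since [S] only has to be
    checked on the first [N] Taylor coefficients, bounding the weights of these
    bounds those of all derivatives. *)
Lemma kspan_der m : kspan (f \o ext_emb F) S (f ('D^m z * c)).
Proof.
elim: (der_span N_gt0 Lz m) => [|a _ x [i iN ->] _ IH].
  by rewrite mul0r rmorph0; apply: kspan0.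
rewrite mulrDl rmorphD; apply: kspanD => //.
have i0 : (i`!)%:R != 0 :> F by apply: fact_neq0_le factN; rewrite -ltnS prednK.
rewrite (der_taylor _ i0) -(rmorph_nat (ext_emb F)) mulrA -rmorphM -mulrA.
by rewrite [f _]rmorphM; apply: (@kspanZ _ _ (f \o ext_emb F)); apply: Sz.
Qed.

Lemma kspan_taylor m : kspan (f \o ext_emb F) S (f (taylor m z * c)).
Proof.
rewrite taylor_emb -mulrA [f _]rmorphM.
by apply: (@kspanZ _ _ (f \o ext_emb F)); apply: kspan_der.
Qed.

End Transfer.

(** * Second solution a power of y *)

(** For [j <= n] the weight [theta j = j * (2 * n + 1 - j)] differs from the
    affine function of [j] on the right by exactly [(j - i) ^ 2]: it is the
    strict concavity of [theta], with a line of slope [2 * (n - i) + 1] touching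
    its graph at [i] only. Beyond [n] the weight is constant while the line
    increases. *)
Lemma weight_le_tangent n i j : (0 < i <= n)%N ->
  (minn j n * (2 * n + 1 - minn j n) + (j != i) <= i * i + (2 * (n - i) + 1) * j)%N.
Proof.
move=> /andP[i0 iN]; have [jn | nj] := leqP j n.
  have -> : (i * i + (2 * (n - i) + 1) * j =
      j * (2 * n + 1 - j) + (j - i + (i - j)) * (j - i + (i - j)))%N.
    by have [ij|ij] := leqP i j; nia.
  by case: (eqVneq j i) => [|ji]; rewrite leq_add2l //; nia.
by case: (eqVneq j i) => [|_]; nia.
Qed.

Section Power.

Variables (K : diffField) (F : diffExt K) (n N q : nat).
Variables (L1 : linDiffPoly K n.+1) (L2 : linDiffPoly K N) (y : F).
Hypotheses (y0 : y != 0) (L1y : ldp_eval L1 y = 0) (L2y : ldp_eval L2 (y ^+ q) = 0).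
Hypotheses (N_gt0 : (0 < N)%N) (Nq : (N <= q)%N) (n_gt0 : (0 < n)%N).
Hypothesis factqn : ((q * n)`!)%:R != 0 :> F.

Let iota : {rmorphism K -> F} := idfun \o ext_emb F.
Let a j := taylor j y * y^-1.
Let theta j := (j * (2 * n + 1 - j))%N.
Let fl := fil iota (fun i : 'I_n => a i.+1) (fun i => theta i.+1).

Let q_gt0 : (0 < q)%N. Proof. exact: leq_trans Nq. Qed.

Let fact0 m : (m <= q * n)%N -> (m`!)%:R != 0 :> F.
Proof. by move=> mqn; apply: fact_neq0_le factqn. Qed.

Let fl_le_n j : (j <= n)%N -> fl (theta j) (a j).
Proof.
case: j => [|j jn]; last exact: (@fil_var _ _ _ _ _ _ (Ordinal jn)).
by rewrite /a /taylor divr1 divff // => _; apply: fil1.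
Qed.

Let theta_le j : (j <= n)%N -> (theta j <= theta n)%N.
Proof. by rewrite /theta; nia. Qed.

Let fl_der j : fl (theta n) ('D^j y * y^-1).
Proof.
apply: (@kspan_der _ _ _ idfun _ L1) => // [|i iN].
  by rewrite /= fact0 // leq_pmull.
by apply: fil_mon (fl_le_n _) => //; apply: theta_le.
Qed.

Let fl_a j : fl (theta (minn j n)) (a j).
Proof.
have [/fl_le_n // | _] := leqP j n.
rewrite /a taylor_emb -mulrA; exact/(@kspanZ _ _ iota)/fl_der.
Qed.

Section Slope.

Variable i : nat.
Hypothesis i_in : (0 < i <= n)%N.

Let s := (2 * (n - i) + 1)%N.

Let fl_slope j : fl (i * i + s * j)%N (a j).
Proof.
apply: fil_mon (fl_a j); apply: leq_trans (weight_le_tangent j i_in).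
exact: leq_addr.
Qed.

Let fl_slope_lt j : j != i -> fl (i * i + s * j).-1 (a j).
Proof.
move=> ji; apply: fil_mon (fl_a j).
have : (theta (minn j n) + 1 <= i * i + s * j)%N.
  by apply: leq_trans (weight_le_tangent j i_in); rewrite ji.
by rewrite addn1 => lt; rewrite -ltnS prednK // (leq_ltn_trans _ lt).
Qed.

(** Among the products of [r.+1] Taylor coefficients [a j] whose indices add up
    to [m], only the one with all indices equal to [i] can have a weight
    reaching the sum [r.+1 * (i * i) + s * m] of the affine bounds, by strict
    concavity. *)
Lemma taylor_power_lead r m : (m <= q * n)%N ->
  fl (r.+1 * (i * i) + s * m).-1
     (taylor m (y ^+ r.+1) * (y ^+ r.+1)^-1 -
      (if m == (r.+1 * i)%N then a i ^+ r.+1 else 0)).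
Proof.
(* The induction starts at the first power: for the zeroth one the bound
   [(r * (i * i) + s * m).-1] would not be strict at [m = 0]. *)
elim: r m => [|r IH] m mqn.
  rewrite !expr1 !mul1n -/(a m); case: (eqVneq m i) => [-> | mi].
    by rewrite subrr; apply: kspan0.
  by rewrite subr0; apply: fl_slope_lt.
have -> : taylor m (y ^+ r.+2) * (y ^+ r.+2)^-1 =
    \sum_(j < m.+1) a j * (taylor (m - j) (y ^+ r.+1) * (y ^+ r.+1)^-1).
  rewrite exprS taylorM ?fact0 // invfM mulr_suml; apply: eq_bigr => j _.
  by rewrite /a; ring.
have -> : (if m == (r.+2 * i)%N then a i ^+ r.+2 else 0) =
    \sum_(j < m.+1) if j == i :> nat then
      a j * (if (m - j == r.+1 * i)%N then a i ^+ r.+1 else 0) else 0.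
  have [im | mi] := leqP i m.
    rewrite (bigD1 (Ordinal (im : i < m.+1)%N)) //= eqxx big1 ?addr0; last first.
      by move=> j; rewrite -val_eqE /= => /negPf ->.
    have -> : (m == r.+2 * i)%N = (m - i == r.+1 * i)%N.
      by rewrite -(eqn_add2l i (m - i)) subnKC.
    by case: ifP; rewrite ?mulr0 // exprS.
  rewrite big1 ?ifN //; first by rewrite mulSn; lia.
  by move=> j _; rewrite ifN //; have := ltn_ord j; lia.
rewrite -sumrB; apply: kspan_sum => j _.
have jm : (j <= m)%N by rewrite -ltnS.
have {}IH := IH (m - j)%N (leq_trans (leq_subr j m) mqn).
have i0 : (0 < i * i)%N by nia.
have ri0 : (0 < r.+1 * (i * i))%N by rewrite muln_gt0.
have e : (r.+2 * (i * i) + s * m = (i * i + s * j) + (r.+1 * (i * i) + s * (m - j)))%N.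
  have sjm : (s * j <= s * m)%N by rewrite leq_mul2l jm orbT.
  rewrite mulnBr; lia.
case: (eqVneq (j : nat) i) => [ji | ji].
  rewrite -mulrBr; apply: fil_mon (filM (fl_slope j) IH).
  by rewrite e; move: (i * i)%N (_ * (_ * _))%N (s * _)%N (s * _)%N i0 ri0; lia.
rewrite subr0; apply: fil_mon (filM (fl_slope_lt ji) _); last first.
  rewrite -(subrK (if (m - j == r.+1 * i)%N then a i ^+ r.+1 else 0) (_ * _)).
  apply: kspanD; first exact: fil_mon IH.
  case: eqP => [-> | _]; last exact: kspan0.
  by apply: fil_mon (filX r.+1 (fl_slope i)); move: s => t; lia.
by rewrite e; move: (i * i)%N (_ * (_ * _))%N (s * _)%N (s * _)%N i0 ri0; lia.
Qed.

(** The Taylor coefficient of [y ^+ q] of order [q * i] has leading term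
    [a i ^+ q]; by the second equation it is a combination of those of order
    less than [N], which is at most [q], hence of smaller weight. *)
Lemma var_power_low : fl (theta i * q).-1 (a i ^+ q).
Proof.
have [r qr] : exists r, q = r.+1 by exists q.-1; rewrite prednK.
have iqn : (q * i <= q * n)%N by rewrite leq_mul2l; lia.
have e : (theta i * q = q * (i * i) + s * (q * i))%N by rewrite /theta /s; nia.
have := taylor_power_lead r iqn; rewrite -qr eqxx -e => lead.
rewrite -[a i ^+ q](subKr (taylor (q * i) (y ^+ q) * (y ^+ q)^-1)).
apply: kspanB => //.
apply: (@kspan_taylor _ _ _ idfun _ L2) => // [|m mN].
  by apply: fact0; nia.
have mqn : (m <= q * n)%N by nia.
have := taylor_power_lead r mqn; rewrite -qr ifN ?subr0; last by nia.
apply: fil_mon; rewrite e.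
have : (s * m <= s * (q * i))%N by rewrite leq_mul2l; apply/orP; right; nia.
by move: (s * m)%N (s * (q * i))%N; lia.
Qed.

End Slope.

Lemma root_power j : root_of_degree_le ('D^j y / y) (q ^ n)%N.
Proof.
apply: (@root_descent _ _ _ idfun).
have := @root_of_fil _ _ iota _ _ _ (fun=> q.-1) _ _ _ _ (fl_der j).
rewrite prod_nat_const card_ord prednK //; apply => i.
  by have := ltn_ord i; rewrite /theta muln_gt0; lia.
by apply: var_power_low; rewrite /= ltn_ord.
Qed.

End Power.

(** * Second solution the inverse of y *)

Section SymmetricFiltration.

Variables (K : fieldType) (E : comNzRingType) (iota : {rmorphism K -> E}).
Variables (n : nat) (v : 'I_n -> E) (w : 'I_n -> nat).
Notation fl := (fil iota v w).

Lemma fil_hsym d s m : {in s, forall x, fl d x} -> fl (d * m) (hsym s m).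
Proof.
elim: s m => [|x s IH] m sd.
  by case: m => [|m]; [apply: fil1 | apply: kspan0].
apply: kspan_sum => j _; have jm : (j <= m)%N by rewrite -ltnS.
have -> : (d * m = d * j + d * (m - j))%N by rewrite -mulnDr subnKC.
apply: filM; first by apply/filX/sd/mem_head.
by apply: IH => z zs; apply: sd; rewrite in_cons zs orbT.
Qed.

Lemma fil_prod_coef d s j : {in s, forall x, fl d x} ->
  fl (d * j) (\prod_(x <- s) (1 - x *: 'X))`_j.
Proof.
elim: s j => [|x s IH] j sd.
  by rewrite big_nil coef1; case: j => [|j]; [apply: fil1 | apply: kspan0].
have {}IH j' : fl (d * j') (\prod_(x <- s) (1 - x *: 'X))`_j'.
  by apply: IH => z zs; apply: sd; rewrite in_cons zs orbT.
rewrite big_cons mulrBl mul1r coefB -scalerAl coefZ coefXM.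
apply: kspanB; first exact: IH.
case: j => [|j]; first by rewrite mulr0; apply: kspan0.
by rewrite mulnS; apply: filM => //; apply/sd/mem_head.
Qed.

End SymmetricFiltration.

Section Inverse.

Variables (K : diffField) (F : diffExt K) (n M : nat).
Variables (L1 : linDiffPoly K n.+1) (L2 : linDiffPoly K M) (y : F).
Hypotheses (y0 : y != 0) (L1y : ldp_eval L1 y = 0) (L2y : ldp_eval L2 y^-1 = 0).
Hypothesis M_gt0 : (0 < M)%N.
Hypothesis factMn : ((M + n).-1`!)%:R != 0 :> F.

Let a j := taylor j y * y^-1.
Let zeta m := taylor m y^-1 * y.

Let fact0 m : (m <= (M + n).-1)%N -> (m`!)%:R != 0 :> F.
Proof. by move=> mMn; apply: fact_neq0_le factMn. Qed.

Let a0 : a 0 = 1.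
Proof. by rewrite /a /taylor divr1 divff. Qed.

Let zeta0 : zeta 0 = 1.
Proof. by rewrite /zeta /taylor divr1 mulVf. Qed.

Let conv m : (m <= (M + n).-1)%N ->
  \sum_(j < m.+1) a j * zeta (m - j) = (m == 0)%:R.
Proof.
move=> mMn; rewrite -(taylor1 F) -(divff y0) taylorM ?fact0 //.
apply: eq_bigr => j _; rewrite /a /zeta; field; exact: y0.
Qed.

Section Roots.

Variables (E : comNzRingType) (f : {rmorphism F -> E}) (s : seq E).
Hypothesis size_s : size s = n.
Hypothesis fs : map_poly f (\poly_(j < n.+1) a j) = \prod_(x <- s) (1 - x *: 'X).

Let iota : {rmorphism K -> E} := f \o ext_emb F.
(* All roots weigh about [B], so that the weight first compares total degrees
   (which are at most [M + n] here), then favours the roots of small index. *)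
Let B := ((M + n) * n)%N.
Let W := (B + n)%N.
Let v (i : 'I_n) := s`_i.
Let w (i : 'I_n) := (B + (n - i))%N.
Let fl := fil iota v w.
Let c j := (\prod_(x <- s) (1 - x *: 'X))`_j.

Let c_le_n j : (j <= n)%N -> c j = f (a j).
Proof. by move=> jn; rewrite /c -fs coef_map coef_poly ltnS jn. Qed.

Let c_gt_n j : (n < j)%N -> c j = 0.
Proof. by move=> jn; rewrite /c -fs coef_map coef_poly ltnS leqNgt jn /= rmorph0. Qed.

Let fl_drop k x : x \in drop k s -> fl (B + (n - k)) x.
Proof.
move=> /(nthP 0)[i]; rewrite size_drop size_s nth_drop => ik <-.
have ikn : (k + i < n)%N by lia.
by apply: fil_mon (fil_var _ _ _ (Ordinal ikn)); rewrite /w /=; lia.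
Qed.

Let fl_s : {in s, forall x, fl W x}.
Proof. by move=> x; rewrite -[s in x \in s]drop0 => /fl_drop; rewrite subn0. Qed.

Let fl_a_le_n j : (j <= n)%N -> fl (W * j) (f (a j)).
Proof. by move=> jn; rewrite -c_le_n //; apply: fil_prod_coef fl_s. Qed.

Let fl_der j : fl (W * n) (f ('D^j y * y^-1)).
Proof.
apply: (kspan_der _ L1y) => // [|i iN]; first by rewrite /= fact0 //; lia.
by apply: fil_mon (fl_a_le_n _) => //; rewrite leq_mul2l -ltnS iN orbT.
Qed.

Let fl_a_gt_n j : (n <= j)%N -> fl (W * j) (f (a j.+1)).
Proof.
move=> nj; apply: fil_mon (_ : fl (W * n) _); first by rewrite leq_mul2l nj orbT.
rewrite /a taylor_emb -mulrA [f _]rmorphM.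
exact/(@kspanZ _ _ iota)/fl_der.
Qed.

Let fl_a j : fl (W * j) (f (a j)).
Proof.
have [/fl_a_le_n // | ] := leqP j n; case: j => // j nj.
by apply: fil_mon (fl_a_gt_n nj); rewrite leq_mul2l leqnSn orbT.
Qed.

Let fl_zeta m : (m <= (M + n).-1)%N -> fl (W * m) (f (zeta m)).
Proof.
elim/ltn_ind: m => -[|m] IH mMn; first by rewrite zeta0 rmorph1; apply: fil1.
move/eqP: (conv mMn); rewrite big_ord_recl a0 mul1r subn0 addr_eq0 => /eqP ->.
rewrite rmorphN rmorph_sum; apply/kspanN/kspan_sum => i _.
rewrite rmorphM lift0 subSS; have im : (i <= m)%N by rewrite -ltnS.
have -> : (W * m.+1 = W * i.+1 + W * (m - i))%N by rewrite -mulnDr addSn subnKC.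
by apply: filM; [apply: fl_a | apply: IH; lia].
Qed.

(** By the second equation the derivatives of [y^-1] of order at least [M] are
    combinations of those of order less than [M]. *)
Let fl_zeta_low m : (M <= m)%N -> fl (W * m.-1) (f (zeta m)).
Proof.
move=> Mm; apply: (kspan_taylor _ L2y) => // [|i iM]; first by rewrite fact0 //; lia.
by apply: fil_mon (fl_zeta _); [rewrite leq_mul2l; apply/orP; right; lia | lia].
Qed.

(** Up to lower degree, [zeta m] is the complete symmetric function of the
    roots: both are coefficients of inverses, of [\sum_j a j T^j] and of its
    truncation at degree [n], and the discarded [a j], those with [n < j], have
    degree at most [n] in the roots. *)
Let fl_hsym_sub m : (m < (M + n).-1)%N ->
  fl (W * m) (hsym s m.+1 - f (zeta m.+1)).
Proof.
elim/ltn_ind: m => m IH mMn.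
have := hsymE s m.+1; rewrite -[RHS](rmorph_nat f) -(conv mMn) rmorph_sum /=.
move/eqP; rewrite -subr_eq0 -sumrB big_ord_recl a0 mul1r subn0 -/(c 0) c_le_n //.
rewrite a0 rmorph1 mul1r addr_eq0 => /eqP ->.
apply/kspanN/kspan_sum => i _; rewrite lift0 subSS -/(c _) rmorphM.
have im : (i <= m)%N by rewrite -ltnS.
have [ni | iN] := leqP n i.
  rewrite c_gt_n // mul0r sub0r.
  have -> : (W * m = W * i + W * (m - i))%N by rewrite -mulnDr subnKC.
  by apply/kspanN/filM; [apply: fl_a_gt_n | apply: fl_zeta; lia].
rewrite c_le_n // -mulrBr.
have [-> | mi] := posnP (m - i)%N.
  by rewrite zeta0 hsym0 rmorph1 subrr mulr0; apply: kspan0.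
have [l ml] : exists l, (m - i = l.+1)%N by exists (m - i).-1; rewrite prednK.
have -> : (W * m = W * i.+1 + W * l)%N by rewrite -mulnDr; congr muln; lia.
rewrite ml.
by apply: filM; [apply: fl_a | apply: IH; lia].
Qed.

Let drop_cons k : (k < n)%N -> drop k s = s`_k :: drop k.+1 s.
Proof. by move=> kn; rewrite -drop_nth ?size_s. Qed.

(** As [hsym (drop k.+1 s) m = hsym (drop k s) m - s`_k * hsym (drop k s) m.-1],
    one root can be dropped at the price of one order [m]. *)
Let fl_hsym_drop k m : (k <= n)%N -> (M + k <= m <= (M + n).-1)%N ->
  fl (W * m.-1) (hsym (drop k s) m).
Proof.
elim: k m => [|k IH] m kn /andP[km mMn].
  rewrite drop0 -(subrK (f (zeta m)) (hsym s m)).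
  apply: kspanD; last by apply: fl_zeta_low; lia.
  by case: m km mMn => [|m] km mMn; [lia | apply: fl_hsym_sub].
case: m km mMn => [|m] km mMn; first by lia.
have -> : hsym (drop k.+1 s) m.+1 = hsym (drop k s) m.+1 - s`_k * hsym (drop k s) m.
  by rewrite (drop_cons kn) hsymS addrK.
apply: kspanB; first by apply: IH; lia.
have -> : (W * m.+1.-1 = W + W * m.-1)%N by rewrite -mulnS; congr muln; lia.
apply: filM; last by apply: IH; lia.
by apply: fl_s; rewrite mem_nth ?size_s.
Qed.

(** With [m = M + i], the expansion of [hsym (drop i s) m] in powers of [s`_i]
    has leading term [s`_i ^+ m]: its other terms have the same degree but
    involve roots of larger index, which are lighter. *)
Let var_power_low (i : 'I_n) : fl (w i * (M.-1 + i).+1).-1 (v i ^+ (M.-1 + i).+1).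
Proof.
have iN := ltn_ord i; set m := (M.-1 + i).+1.
have mE : m = (M + i)%N by rewrite /m -addSn prednK.
have wi : (0 < w i)%N by rewrite /w; lia.
have := @fl_hsym_drop i m (ltnW iN); rewrite mE leqnn /= -mE => /(_ _) hm.
rewrite -[v i ^+ m](addrK (\sum_(j < m) v i ^+ j * hsym (drop i.+1 s) (m - j))).
apply: kspanB.
  rewrite (_ : _ + _ = hsym (drop i s) m).
    apply: fil_mon (hm _); last by rewrite mE; lia.
    have Wi : W = (w i + i)%N by rewrite /w /W; lia.
    have miB : (m * i <= B)%N by rewrite leq_mul //; lia.
    rewrite Wi /m /= in miB *; have : (B < w i)%N by rewrite /w; lia.
    by move: (w i) (M.-1 + i)%N miB => t l; nia.
  by rewrite (drop_cons iN) hsym_cons [RHS]big_ord_recr subnn hsym0 mulr1 addrC.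
apply: kspan_sum => j _; have jm := ltn_ord j.
have drop_w : {in drop i.+1 s, forall x, fl (w i).-1 x}.
  by move=> x /fl_drop; rewrite /w; apply: fil_mon; lia.
apply: fil_mon (filM (filX j (fil_var _ _ _ i)) (fil_hsym _ drop_w)).
suff bound d e t : (d < e -> 0 < t -> t * d + t.-1 * (e - d) <= (t * e).-1)%N.
  exact: bound.
by case: t => // t de _; nia.
Qed.

Lemma root_inverse_split j : root_of_degree_le ('D^j y / y) (\prod_(i < n) (M + i))%N.
Proof.
apply: (@root_descent _ _ _ f).
have := root_of_fil (c := fun i : 'I_n => (M.-1 + i)%N) _ var_power_low (fl_der j).
under eq_bigr do rewrite -addSn prednK //.
by apply=> i; have := ltn_ord i; rewrite /w; lia.
Qed.

End Roots.

Lemma root_inverse j : root_of_degree_le ('D^j y / y) (\prod_(i < n) (M + i))%N.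
Proof.
have [] := @splitting_ring n F (\poly_(j < n.+1) a j).
- by rewrite coef_poly a0.
- exact: size_poly.
by move=> E [f [s [ss fs]]]; apply: root_inverse_split fs j.
Qed.

End Inverse.

(** * The theorem *)

Lemma fact_neq0_of_char (R : idomainType) p N m :
    has_char R p -> p = 0%N \/ (N < p)%N -> (m <= N)%N -> (m`!)%:R != 0 :> R.
Proof.
move=> hp pN mN; case: hp => [[_ /pcharf0P ->] | pR]; first by rewrite -lt0n fact_gt0.
have p_pr := pcharf_prime pR; rewrite -(dvdn_pcharf pR).
have {pN mN} mp : (m < p)%N.
  by case: pN => [p0 | Np]; [rewrite p0 in p_pr | apply: leq_ltn_trans Np].
elim: m mp => [|m IH] mp; first by rewrite dvdn1 neq_ltn prime_gt1 ?orbT.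
by rewrite factS Euclid_dvdM // negb_or gtnNdvd // IH // ltnW.
Qed.

Lemma prod_rising_fact M n : (0 < M)%N ->
  ((M + n).-1`! %/ (M.-1)`! = \prod_(i < n) (M + i))%N.
Proof.
case: M => // M _; apply/eqP; rewrite -[_ == _](eqn_pmul2r (fact_gt0 M)) addSn /=.
have E : (\prod_(i < n) (M.+1 + i) * M`! = (M + n)`!)%N.
  elim: n => [|n IH]; first by rewrite big_ord0 mul1n addn0.
  by rewrite big_ord_recr /= mulnAC IH addnS factS mulnC addSn.
by rewrite -E mulnK ?fact_gt0.
Qed.

Lemma root_of_degree_leW (K : diffField) (F : diffExt K) (x : F) d e :
  (d <= e)%N -> root_of_degree_le x d -> root_of_degree_le x e.
Proof. by move=> de [P [P0 sP rP]]; exists P; split=> //; apply: leq_trans sP _. Qed.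

Lemma root_of_degree_le_algebraic (K : diffField) (F : diffExt K) (x : F) d :
  root_of_degree_le x d -> algebraic x.
Proof. by move=> [P [P0 _ rP]]; exists P. Qed.

Theorem theorem1p2 (N1 N2 : nat) (hN1 : (1 < N1)%N) (hN2 : (1 < N2)%N)
    (p : nat) (K : diffField) (hp : has_char K p) (F : diffExt K)
    (L1 : linDiffPoly K N1) (L2 : linDiffPoly K N2) (y : F) (hy : y != 0) :
  let case1 :=
    (p = 0%N \/ (N1 + N2 - 2 < p)%N) /\
    (ldp_eval L1 y = 0 /\ ldp_eval L2 (1 / y) = 0) in
  let case2 (q : nat) :=
    [/\ (0 < q)%N, (N2 <= q)%N,
        p = 0%N \/ ((q + 1) * (N1 - 1) - 1 < p)%N
      & ldp_eval L1 y = 0 /\ ldp_eval L2 (y ^+ q) = 0] in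
  (case1 \/ (exists q : nat, case2 q) ->
     forall j : nat, (1 <= j)%N -> algebraic ('D^j y / y)) /\
  (forall j : nat, (1 <= j <= N1 - 1)%N ->
     (case1 ->
        root_of_degree_le ('D^j y / y)
          ((N2 + N1 - 2)`! %/ (N2 - 1)`!)%N) /\
     (forall q : nat, case2 q ->
        root_of_degree_le ('D^j y / y)
          ((q * (N1 - 1) + N1 - 2)`! %/ (q * (N1 - 1) - 1)`!)%N)).
Proof.
case: N1 hN1 L1 => // n n_gt0 L1; rewrite ltnS in n_gt0.
have N2_gt0 : (0 < N2)%N by apply: ltnW.
move=> case1 case2.
have fact0 := fact_neq0_of_char hp.
have bound1 j : case1 -> root_of_degree_le ('D^j y / y)
    ((N2 + n.+1 - 2)`! %/ (N2 - 1)`!)%N.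
  case=> pN [L1y L2y]; rewrite div1r in L2y.
  have -> : (N2 + n.+1 - 2 = (N2 + n).-1)%N by lia.
  rewrite subn1 prod_rising_fact //; apply: (root_inverse hy L1y L2y) => //.
  by rewrite -(rmorph_nat (ext_emb F)) fmorph_eq0 (fact0 _ _ pN) //; lia.
have bound2 j q : case2 q -> root_of_degree_le ('D^j y / y)
    ((q * (n.+1 - 1) + n.+1 - 2)`! %/ (q * (n.+1 - 1) - 1)`!)%N.
  case=> q_gt0 Nq pN [L1y L2y]; rewrite !subn1 /= in pN *.
  have -> : (q * n + n.+1 - 2 = (q * n + n).-1)%N by lia.
  rewrite prod_rising_fact ?muln_gt0 ?q_gt0 //.
  apply: root_of_degree_leW (root_power hy L1y L2y N2_gt0 Nq n_gt0 _ j).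
    rewrite -[n in (q ^ n)%N]card_ord -prod_nat_const; apply: leq_prod => i _.
    by apply: leq_trans (leq_addr i _); rewrite leq_pmulr.
  by rewrite -(rmorph_nat (ext_emb F)) fmorph_eq0 (fact0 _ _ pN) //; lia.
split=> [cases j _ | j _]; last by split=> [/bound1 | q /bound2].
by case: cases => [/(bound1 j) | [q /(bound2 j)]]; apply: root_of_degree_le_algebraic.
Qed.
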